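(* Let $a_1,a_2,b_1,b_2,c,t_1,t_2$ be complex numbers with $\Re(c)\neq 0,-1,\dots$ and let $k_1,k_2\in\mathbb{N}$ be positive. The discrete Appell function $\mathcal{F}^{(1)}_3=\mathcal{F}^{(1)}_3(a_1,a_2,b_1,b_2;c;t_1,t_2,k_1,k_2,x,y)$, $|x|<1$, $|y|<1$, satisfies the following difference equations: $$\left[\Theta_{t_1}\left(\frac{1}{k_1}\Theta_{t_1}+\frac{1}{k_2}\Theta_{t_2}+c-1\right)-k_1(-1)^{k_1}(-t_1)_{k_1}\,x\,\rho_{t_1}^{k_1}\left(\frac{1}{k_1}\Theta_{t_1}+a_1\right)\left(\frac{1}{k_1}\Theta_{t_1}+b_1\right)\right]\mathcal{F}^{(1)}_3=0;$$ $$\left[\Theta_{t_2}\left(\frac{1}{k_1}\Theta_{t_1}+\frac{1}{k_2}\Theta_{t_2}+c-1\right)-k_2(-1)^{k_2}(-t_2)_{k_2}\,y\,\rho_{t_2}^{k_2}\left(\frac{1}{k_2}\Theta_{t_2}+a_2\right)\left(\frac{1}{k_2}\Theta_{t_2}+b_2\right)\right]\mathcal{F}^{(1)}_3=0.$$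
   Context: $(z)_n=z(z+1)\cdots(z+n-1)$, $(z)_0=1$, is the Pochhammer symbol. The first discrete Appell function is the function defined by the double series $$\mathcal{F}^{(1)}_3(a_1,a_2,b_1,b_2;c;t_1,t_2,k_1,k_2,x,y)=\sum_{m,n\ge 0}\frac{(a_1)_m(a_2)_n(b_1)_m(b_2)_n(-1)^{mk_1}(-t_1)_{mk_1}(-1)^{nk_2}(-t_2)_{nk_2}}{(c)_{m+n}\,m!\,n!}\,x^m y^n,$$ which the paper asserts to converge absolutely for $|x|<1$, $|y|<1$ and arbitrary complex $t_1,t_2$. For a function $f$ of $t$: $\Delta_t f(t)=f(t+1)-f(t)$, $\rho_t f(t)=f(t-1)$, and $\Theta_t=t\,\rho_t\,\Delta_t$, i.e. $(\Theta_t f)(t)=t\,(f(t)-f(t-1))$. Operators are composed right to left; in $(-t_1)_{k_1}\,x\,\rho_{t_1}^{k_1}(\cdots)$ the shift $\rho_{t_1}^{k_1}$ (which replaces $t_1$ by $t_1-k_1$) is applied to the result of the factors on its right, and then one multiplies by $(-t_1)_{k_1}x$ (similarly for $t_2$).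
   Formalization: The double series diverges unless it terminates in both m and n, so for generic t1, t2 the function is undefined; it is set to 0 wherever the series does not converge absolutely, and the two equations are also stated for the series as a formal power series in x, y for all t1, t2. *)

(* Defs.v *)
From mathcomp Require Import all_boot all_order all_algebra.
From mathcomp Require Import complex.
From mathcomp Require Import all_classical all_reals all_analysis.

Set Implicit Arguments.
Unset Strict Implicit.
Unset Printing Implicit Defensive.

Import Order.TTheory GRing.Theory Num.Theory.
Import numFieldNormedType.Exports.

Local Open Scope ring_scope.

Definition poch (K : pzRingType) (z : K) (n : nat) : K :=
  \prod_(i < n) (z + i%:R).

Definition Delta (K : pzRingType) (f : K -> K) : K -> K :=
  fun t => f (t + 1) - f t.

Definition rho (K : pzRingType) (f : K -> K) : K -> K := fun t => f (t - 1).

Definition Theta (K : pzRingType) (f : K -> K) : K -> K :=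
  fun t => t * rho (Delta f) t.

(* A one-variable operator acting on the first, resp. second, variable of a   *)
(* function of (t1, t2); e.g. on1 (@Theta K) is Theta_{t1}.                   *)
Definition on1 (K : Type) (T : (K -> K) -> K -> K) (f : K -> K -> K) :
    K -> K -> K :=
  fun t1 t2 => T (fun s => f s t2) t1.

Definition on2 (K : Type) (T : (K -> K) -> K -> K) (f : K -> K -> K) :
    K -> K -> K :=
  fun t1 t2 => T (f t1) t2.

(* (1/k1) Theta_{t1} + (1/k2) Theta_{t2} + c - 1 *)
Definition opC (K : unitRingType) (k1 k2 : nat) (c : K) (f : K -> K -> K) :
    K -> K -> K :=
  fun t1 t2 => k1%:R^-1 * on1 (@Theta K) f t1 t2
             + k2%:R^-1 * on2 (@Theta K) f t1 t2 + (c - 1) * f t1 t2.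

(* (1/k) Theta_{t1} + a and (1/k) Theta_{t2} + a *)
Definition opA1 (K : unitRingType) (k : nat) (a : K) (f : K -> K -> K) :
    K -> K -> K :=
  fun t1 t2 => k%:R^-1 * on1 (@Theta K) f t1 t2 + a * f t1 t2.

Definition opA2 (K : unitRingType) (k : nat) (a : K) (f : K -> K -> K) :
    K -> K -> K :=
  fun t1 t2 => k%:R^-1 * on2 (@Theta K) f t1 t2 + a * f t1 t2.

(* The coefficient of x ^ m y ^ n in F_3^(1). *)
Definition coefF3 (K : unitRingType) (a1 a2 b1 b2 c : K) (k1 k2 m n : nat)
    (t1 t2 : K) : K :=
  (poch a1 m * poch a2 n * poch b1 m * poch b2 n
   * (-1) ^+ (m * k1) * poch (- t1) (m * k1)
   * (-1) ^+ (n * k2) * poch (- t2) (n * k2))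
  / (poch c (m + n) * (m`!)%:R * (n`!)%:R).

Definition abs_cvg2 (R : realType) (u : nat -> nat -> R[i]) : Prop :=
  summable [set: nat * nat] (fun p => (complex.Re `|u p.1 p.2|)%:E).

(* The sum of an absolutely convergent double series, as the limit of its     *)
(* square partial sums (R[i]^o is R[i] with its norm topology); by convention *)
(* it is 0 when the series does not converge absolutely.                      *)
Definition dsum (R : realType) (u : nat -> nat -> R[i]) : R[i] :=
  if `[< abs_cvg2 u >]
  then limn (fun N => (\sum_(m < N) \sum_(n < N) u m n : R[i]^o))
  else 0.

(* Pitfall: for k1, k2 > 0 and c not in {0, -1, ...}, this series converges   *)
(* absolutely exactly when it terminates in both indices (x = 0, or a1 or b1  *)
(* in {0, -1, ...}, or t1 a natural number; similarly for n). Elsewhere       *)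
(* appellF3 takes the conventional value 0.                                   *)
Definition appellF3 (R : realType) (a1 a2 b1 b2 c t1 t2 : R[i])
    (k1 k2 : nat) (x y : R[i]) : R[i] :=
  dsum (fun m n => coefF3 a1 a2 b1 b2 c k1 k2 m n t1 t2 * x ^+ m * y ^+ n).

(* A formal double power series in x, y whose coefficients are functions of   *)
(* (t1, t2) is given by its coefficients u m n; mulx and muly multiply it by  *)
(* x and by y.                                                                *)
Definition mulx (K : pzRingType) (u : nat -> nat -> K -> K -> K) :
    nat -> nat -> K -> K -> K :=
  fun m n t1 t2 => if m is m'.+1 then u m' n t1 t2 else 0.

Definition muly (K : pzRingType) (u : nat -> nat -> K -> K -> K) :
    nat -> nat -> K -> K -> K :=
  fun m n t1 t2 => if n is n'.+1 then u m n' t1 t2 else 0.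

(* Main.v *)
Require Import Defs.
From mathcomp Require Import all_boot all_order all_algebra.
From mathcomp Require Import complex.
From mathcomp Require Import all_classical all_reals all_analysis.
From mathcomp Require Import ring zify.

(* Theta multiplies (-t)_j by j, so the coefficient of x^m y^n is an          *)
(* eigenfunction of all the operators involved, and each equation reduces     *)
(* to the two-term recurrence in m (resp. n) of the coefficients.             *)
(* For the function itself: where both indices terminate, the sum is finite   *)
(* and the recurrence telescopes; elsewhere the ratio test makes the series   *)
(* diverge and F_3^(1) has the value 0. The equation at (t1, t2) never mixes  *)
(* the two regimes: going down from a natural t1 one would leave the          *)
(* terminating regime only after 0, and there the factor t of Theta, or       *)
(* (-t1)_{k1} in front of the shift by k1, vanishes. The second equation is   *)
(* the first one with the roles of the two indices exchanged.                 *)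

Set Implicit Arguments.
Unset Strict Implicit.
Unset Printing Implicit Defensive.

Import Order.TTheory GRing.Theory Num.Theory.
Import numFieldNormedType.Exports.

Local Open Scope ring_scope.

(** Since $\Theta_t(-t)_j=j\,(-t)_j$ ([Theta_poch]), on the coefficient of $x^my^n$ the operators
    $\frac1{k_1}\Theta_{t_1}$ and $\frac1{k_2}\Theta_{t_2}$ multiply by $m$ and $n$, while
    $(-t_1)_{k_1}\rho_{t_1}^{k_1}$ turns $(-t_1)_{mk_1}$ into $(-t_1)_{(m+1)k_1}$. The first
    equation thus amounts to [coefF3_recurrence], which gives the formal version [coefF3_formal1] at
    once. For the function, [appellF3_terminating] yields a finite sum, handled by telescoping in
    [comb_eqn1], and [appellF3_divergent] yields the value 0; [eqn1_eq_on] allows $F$ to be replaced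
    by either one near the given point. The symmetry [appellF3C] transfers the result to the second
    equation. *)

Section Pochhammer.
Variable K : comPzRingType.
Implicit Types z : K.

Lemma poch0 z : poch z 0 = 1.
Proof. exact: big_ord0. Qed.

Lemma pochS z n : poch z n.+1 = poch z n * (z + n%:R).
Proof. exact: big_ord_recr. Qed.

Lemma pochD z m n : poch z (m + n) = poch z m * poch (z + m%:R) n.
Proof.
rewrite /poch big_split_ord; congr (_ * _); apply: eq_bigr => i _ /=.
by rewrite natrD addrA.
Qed.

Lemma pochSl z n : poch z n.+1 = z * poch (z + 1) n.
Proof. by rewrite -[n.+1]add1n pochD pochS poch0 mul1r addr0. Qed.

End Pochhammer.

Lemma poch_neq0 (K : idomainType) (z : K) n :
  (forall i, z + i%:R != 0) -> poch z n != 0.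
Proof. by move=> z_neq0; apply/prodf_neq0. Qed.

Lemma poch_eq0P (K : idomainType) (z : K) n :
  reflect (exists2 i, (i < n)%N & z + i%:R = 0) (poch z n == 0).
Proof.
apply: (iffP idP) => [/prodf_eq0 [i _ /eqP zi0]|[i lt_in zi0]].
  by exists (i : nat).
by apply/prodf_eq0; exists (Ordinal lt_in) => //; apply/eqP.
Qed.

Section Theta.
Variable K : comPzRingType.

Lemma ThetaE (f : K -> K) t : Theta f t = t * (f t - f (t - 1)).
Proof. by rewrite /Theta /rho /Delta subrK. Qed.

Lemma iter_on1_rho k (f : K -> K -> K) t1 t2 :
  iter k (on1 (@rho K)) f t1 t2 = f (t1 - k%:R) t2.
Proof.
elim: k t1 => [|k IHk] t1; first by rewrite subr0.
by rewrite iterS /on1 /rho IHk -addrA -opprD nat1r.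
Qed.

(** Splitting off the first or the last factor of $(-t)_{j+1}$ gives $-t\,(1-t)_j=(-t)_j(j-t)$;
    adding $t\,(-t)_j$ leaves $j\,(-t)_j$. *)
Lemma Theta_poch (A t : K) j :
  Theta (fun s => A * poch (- s) j) t = j%:R * (A * poch (- t) j).
Proof.
rewrite ThetaE; have := pochS (- t) j; rewrite pochSl opprB [1 - t]addrC => e.
have -> : t * (A * poch (- t) j - A * poch (- t + 1) j)
    = A * (t * poch (- t) j + - t * poch (- t + 1) j) by ring.
by rewrite e; ring.
Qed.

End Theta.

(* Theta f at 0 is 0 whatever f (-1) is, so the shift at 0 can be left out.    *)
Definition shift_closed (K : pzRingType) (D : K -> Prop) :=
  forall s, D s -> s <> 0 -> D (s - 1).

(** * Locality: which values of a function the equation depends on *)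

Section Congruence.
Variable K : fieldType.
Variables D1 D2 : K -> Prop.
Hypotheses (D1_closed : shift_closed D1) (D2_closed : shift_closed D2).

Definition eq_on (f g : K -> K -> K) :=
  forall s1 s2, D1 s1 -> D2 s2 -> f s1 s2 = g s1 s2.

(** When $(-t)_k\neq0$, none of $t,t-1,\dots,t-k+1$ is 0, so all $k$ backward steps stay in [D]. *)
Lemma shift_closed_sub (D : K -> Prop) k t :
  shift_closed D -> D t -> poch (- t) k != 0 -> D (t - k%:R).
Proof.
move=> D_closed Dt; elim: k => [|k IHk]; first by rewrite subr0.
rewrite pochS mulf_eq0 negb_or => /andP[/IHk Dtk tk_neq0].
rewrite -natr1 opprD addrA; apply: D_closed => // /eqP tk0.
by move: tk_neq0; rewrite -oppr_eq0 opprD opprK tk0.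
Qed.

Lemma on1_Theta_eq_on f g :
  eq_on f g -> eq_on (on1 (@Theta K) f) (on1 (@Theta K) g).
Proof.
move=> fg s1 s2 Ds1 Ds2; rewrite /on1 !ThetaE fg //.
have [->|/eqP s1_neq0] := eqVneq s1 0; first by rewrite !mul0r.
by rewrite fg //; apply: D1_closed.
Qed.

Lemma on2_Theta_eq_on f g :
  eq_on f g -> eq_on (on2 (@Theta K) f) (on2 (@Theta K) g).
Proof.
move=> fg s1 s2 Ds1 Ds2; rewrite /on2 !ThetaE fg //.
have [->|/eqP s2_neq0] := eqVneq s2 0; first by rewrite !mul0r.
by rewrite fg //; apply: D2_closed.
Qed.

Lemma opC_eq_on k1 k2 c f g : eq_on f g -> eq_on (opC k1 k2 c f) (opC k1 k2 c g).
Proof.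
move=> fg s1 s2 Ds1 Ds2.
by rewrite /opC (on1_Theta_eq_on fg) // (on2_Theta_eq_on fg) // fg.
Qed.

Lemma opA1_eq_on k a f g : eq_on f g -> eq_on (opA1 k a f) (opA1 k a g).
Proof.
by move=> fg s1 s2 Ds1 Ds2; rewrite /opA1 (on1_Theta_eq_on fg) // fg.
Qed.

End Congruence.

Definition eqn1 (K : fieldType) (a1 b1 c x : K) (k1 k2 : nat)
    (f : K -> K -> K) (t1 t2 : K) : K :=
  on1 (@Theta K) (opC k1 k2 c f) t1 t2
  - k1%:R * (-1) ^+ k1 * poch (- t1) k1 * x
    * iter k1 (on1 (@rho K)) (opA1 k1 a1 (opA1 k1 b1 f)) t1 t2.

(** Backward shifts that would leave the domain are always multiplied by zero: by the factor $t$ of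
    [Theta], or by $(-t_1)_{k_1}$ in front of the iterated shift. *)
Lemma eqn1_eq_on (K : fieldType) (a1 b1 c x : K) k1 k2 (D1 D2 : K -> Prop)
    f g t1 t2 :
  shift_closed D1 -> shift_closed D2 -> eq_on D1 D2 f g -> D1 t1 -> D2 t2 ->
  eqn1 a1 b1 c x k1 k2 f t1 t2 = eqn1 a1 b1 c x k1 k2 g t1 t2.
Proof.
move=> D1c D2c fg Dt1 Dt2; rewrite /eqn1 !iter_on1_rho.
rewrite (on1_Theta_eq_on D1c (opC_eq_on D1c D2c k1 k2 c fg)) //.
have [->|t1_neq0] := eqVneq (poch (- t1) k1) 0; first by rewrite mulr0 !mul0r.
rewrite (opA1_eq_on D1c k1 a1 (opA1_eq_on D1c k1 b1 fg)) //.
exact: shift_closed_sub.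
Qed.

Lemma eqn1_0 (K : fieldType) (a1 b1 c x : K) k1 k2 t1 t2 :
  eqn1 a1 b1 c x k1 k2 (fun _ _ => 0) t1 t2 = 0.
Proof.
rewrite /eqn1 iter_on1_rho /opA1 /opC /on1 /on2 !ThetaE.
by rewrite !(subrr, mulr0, addr0).
Qed.

(** * Coefficients as joint eigenfunctions; the recurrence and its telescoping *)

Section Eigen.
Variables (K : numFieldType) (a1 a2 b1 b2 c : K) (k1 k2 : nat).
Hypotheses (c_neq0 : forall j, c + j%:R != 0).
Hypotheses (hk1 : (0 < k1)%N) (hk2 : (0 < k2)%N).
Local Notation U := (coefF3 a1 a2 b1 b2 c k1 k2).

(** The weights [l] do not depend on $s_1,s_2$, so each operator acts on such a combination only by
    rescaling them. A one-element list [r] serves the formal equations, a rectangle the truncated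
    series. *)
Definition comb (r : seq (nat * nat)) (l : nat * nat -> K) (s1 s2 : K) : K :=
  \sum_(p <- r) l p * U p.1 p.2 s1 s2.

Lemma on1_Theta_comb r l : on1 (@Theta K) (comb r l) =
  comb r (fun p => k1%:R * p.1%:R * l p).
Proof.
apply/funext => s1; apply/funext => s2.
rewrite /on1 ThetaE /comb -sumrB mulr_sumr; apply: eq_bigr => -[m n] _ /=.
(* [A] gathers all that is constant in the first variable, to match the form of [Theta_poch]. *)
pose A := l (m, n) * poch a1 m * poch a2 n * poch b1 m * poch b2 n
   * (-1) ^+ (m * k1) * (-1) ^+ (n * k2) * poch (- s2) (n * k2)
  / (poch c (m + n) * (m`!)%:R * (n`!)%:R).
have UE s : l (m, n) * U m n s s2 = A * poch (- s) (m * k1).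
  by rewrite /A /coefF3; ring.
rewrite -mulrA !UE -(ThetaE (fun s => A * poch (- s) (m * k1))) Theta_poch.
by rewrite natrM; ring.
Qed.

Lemma on2_Theta_comb r l : on2 (@Theta K) (comb r l) =
  comb r (fun p => k2%:R * p.2%:R * l p).
Proof.
apply/funext => s1; apply/funext => s2.
rewrite /on2 ThetaE /comb -sumrB mulr_sumr; apply: eq_bigr => -[m n] _ /=.
pose A := l (m, n) * poch a1 m * poch a2 n * poch b1 m * poch b2 n
   * (-1) ^+ (m * k1) * (-1) ^+ (n * k2) * poch (- s1) (m * k1)
  / (poch c (m + n) * (m`!)%:R * (n`!)%:R).
have UE s : l (m, n) * U m n s1 s = A * poch (- s) (n * k2).
  by rewrite /A /coefF3; ring.
rewrite -mulrA !UE -(ThetaE (fun s => A * poch (- s) (n * k2))) Theta_poch.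
by rewrite natrM; ring.
Qed.

Lemma opA1_comb r l a : opA1 k1 a (comb r l) =
  comb r (fun p => (p.1%:R + a) * l p).
Proof.
apply/funext => s1; apply/funext => s2.
rewrite /opA1 on1_Theta_comb /comb !mulr_sumr -big_split.
apply: eq_bigr => p _ /=.
have k1_neq0 : k1%:R != 0 :> K by rewrite pnatr_eq0 -lt0n.
by field.
Qed.

Lemma opC_comb r l : opC k1 k2 c (comb r l) =
  comb r (fun p => ((p.1 + p.2)%:R + c - 1) * l p).
Proof.
apply/funext => s1; apply/funext => s2.
rewrite /opC on1_Theta_comb on2_Theta_comb /comb !mulr_sumr -!big_split.
apply: eq_bigr => p _ /=; rewrite natrD.
have k1_neq0 : k1%:R != 0 :> K by rewrite pnatr_eq0 -lt0n.
have k2_neq0 : k2%:R != 0 :> K by rewrite pnatr_eq0 -lt0n.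
by field; rewrite k2_neq0.
Qed.

(** By [pochD], $(-t_1)_{k_1}(k_1-t_1)_{mk_1}=(-t_1)_{(m+1)k_1}$; what remains is the ratio
    $(a_1+m)(b_1+m)/((c+m+n)(m+1))$ of consecutive coefficients. *)
Lemma coefF3_recurrence m n t1 t2 :
  (-1) ^+ k1 * poch (- t1) k1
    * ((m%:R + a1) * (m%:R + b1) * U m n (t1 - k1%:R) t2)
  = m.+1%:R * ((m + n)%:R + c) * U m.+1 n t1 t2.
Proof.
rewrite /coefF3 addSn !pochS mulSn exprD (pochD (- t1)) factS natrM.
rewrite opprB [k1%:R - _]addrC.
have pc_neq0 : poch c (m + n) != 0 by exact: poch_neq0.
have := c_neq0 (m + n); have : 1 + m%:R != 0 :> K by rewrite nat1r pnatr_eq0.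
have : (m`!)%:R != 0 :> K by rewrite pnatr_eq0 -lt0n fact_gt0.
have : (n`!)%:R != 0 :> K by rewrite pnatr_eq0 -lt0n fact_gt0.
rewrite natrD => ? ? ? ?.
by field; apply/and5P; split.
Qed.

Lemma coefF3_comb m n : U m n = comb [:: (m, n)] (fun=> 1).
Proof.
by apply/funext => s1; apply/funext => s2; rewrite /comb big_seq1 mul1r.
Qed.

Lemma on1_Theta_opC_coefF3 m n t1 t2 :
  on1 (@Theta K) (opC k1 k2 c (U m n)) t1 t2
  = k1%:R * m%:R * ((m + n)%:R + c - 1) * U m n t1 t2.
Proof.
by rewrite coefF3_comb opC_comb on1_Theta_comb /comb !big_seq1 /=; ring.
Qed.

Lemma coefF3_formal1 m n t1 t2 :
  on1 (@Theta K) (opC k1 k2 c (U m n)) t1 t2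
  - k1%:R * (-1) ^+ k1 * poch (- t1) k1
    * mulx (fun p q => iter k1 (on1 (@rho K))
                         (opA1 k1 a1 (opA1 k1 b1 (U p q)))) m n t1 t2 = 0.
Proof.
rewrite on1_Theta_opC_coefF3; case: m => [|m] /=.
  by rewrite !(mulr0, mul0r) subrr.
rewrite (coefF3_comb m n) !opA1_comb iter_on1_rho /comb big_seq1 /= mulr1 -!mulrA.
rewrite [(-1) ^+ k1 * _]mulrA [(m%:R + a1) * _]mulrA coefF3_recurrence addSn.
by rewrite -natr1; ring.
Qed.

(** The [Theta] part is $\sum_{m<M}h(m)$ and, by the recurrence, the shifted part is
    $\sum_{m<M}h(m+1)$. Their difference is $h(0)-h(M)$, where $h(0)=0$ because of the eigenvalue
    $m$ and $h(M)=0$ by the assumption on the boundary row. *)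
Lemma comb_eqn1 x y M N t1 t2 :
  (forall n, x ^+ M * U M n t1 t2 = 0) ->
  eqn1 a1 b1 c x k1 k2
    (fun s1 s2 => \sum_(m < M) \sum_(n < N) U m n s1 s2 * x ^+ m * y ^+ n)
    t1 t2 = 0.
Proof.
move=> UM0; pose l (p : nat * nat) := x ^+ p.1 * y ^+ p.2.
pose r := [seq (m, n) | m <- iota 0 M, n <- iota 0 N].
have sumr (G : nat * nat -> K) :
    \sum_(p <- r) G p = \sum_(m < M) \sum_(n < N) G (m : nat, n : nat).
  rewrite big_allpairs -{1}[M]subn0 big_mkord; apply: eq_bigr => m _.
  by rewrite -{1}[N]subn0 big_mkord.
have -> : (fun s1 s2 => \sum_(m < M) \sum_(n < N) U m n s1 s2 * x ^+ m * y ^+ n)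
    = comb r l.
  apply/funext => s1; apply/funext => s2; rewrite /comb sumr.
  by apply: eq_bigr => m _; apply: eq_bigr => n _; rewrite /l /=; ring.
rewrite /eqn1 iter_on1_rho opC_comb on1_Theta_comb !opA1_comb /comb mulr_sumr.
pose h m := \sum_(n < N) k1%:R * m%:R * ((m + n)%:R + c - 1) * l (m, n : nat)
  * U m n t1 t2.
have -> : \sum_(p <- r) k1%:R * p.1%:R * (((p.1 + p.2)%:R + c - 1) * l p)
   * U p.1 p.2 t1 t2 = \sum_(m < M) h m.
  rewrite sumr; apply: eq_bigr => m _; apply: eq_bigr => n _ /=; ring.
rewrite sumr [X in _ - X](_ : _ = \sum_(m < M) h m.+1); last first.
  apply: eq_bigr => m _; apply: eq_bigr => n _ /=.
  have e := coefF3_recurrence m n t1 t2.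
  transitivity (k1%:R * x * l (m : nat, n : nat) *
     (m.+1%:R * ((m + n)%:R + c) * U m.+1 n t1 t2)); first by rewrite -e; ring.
  by rewrite addSn -!natr1 /l /= exprS; ring.
have h0 : h 0%N = 0 by apply: big1 => n _; rewrite mulr0 !mul0r.
have hM : h M = 0.
  apply: big1 => n _; rewrite /l /=.
  transitivity (k1%:R * M%:R * ((M + n)%:R + c - 1) * y ^+ n
    * (x ^+ M * U M n t1 t2)); first by ring.
  by rewrite UM0 mulr0.
apply/eqP; rewrite subr_eq0; apply/eqP.
have : \sum_(m < M.+1) h m = h 0%N + \sum_(m < M) h m.+1.
  by rewrite big_ord_recl.
by rewrite big_ord_recr /= h0 hM addr0 add0r.
Qed.

End Eigen.

(** * Double series: symmetry, finite support, divergence *)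

Section DoubleSeries.
Local Open Scope classical_set_scope.
Local Open Scope ring_scope.
Variable R : realType.
Implicit Types u : nat -> nat -> R[i].

Lemma abs_cvg2C u : abs_cvg2 (fun m n => u n m) <-> abs_cvg2 u.
Proof.
suff {u} swap u : abs_cvg2 u -> abs_cvg2 (fun m n => u n m).
  by split; apply: swap.
rewrite /abs_cvg2 /summable => ucvg.
rewrite (reindex_esum [set: nat * nat] _ (fun p => (p.2, p.1))) //.
by split=> // [[? ?] [? ?] _ _ [-> ->] //|[m n] _]; exists (n, m).
Qed.

Lemma dsumC u : dsum (fun m n => u n m) = dsum u.
Proof.
rewrite /dsum (asbool_equiv_eq (abs_cvg2C u)); case: ifP => // _.
by under eq_fun do rewrite exchange_big.
Qed.

Lemma sum_trunc (V : nmodType) (f : nat -> V) M N :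
  (M <= N)%N -> (forall m, (M <= m)%N -> f m = 0) ->
  \sum_(m < N) f m = \sum_(m < M) f m.
Proof.
move=> /subnKC <- f0; rewrite big_split_ord /= [X in _ + X]big1 ?addr0 // => i _.
by rewrite f0 // leq_addr.
Qed.

Lemma dsum_finite u M N :
  (forall m n, (M <= m)%N || (N <= n)%N -> u m n = 0) ->
  dsum u = \sum_(m < M) \sum_(n < N) u m n.
Proof.
move=> u0; rewrite /dsum.
have -> : `[< abs_cvg2 u >] = true.
  apply/asboolP; rewrite /abs_cvg2 /summable.
  pose B : set (nat * nat) := (`I_M `*` `I_N).
  have finB : finite_set B by apply: finite_setX; exact: finite_II.
  rewrite [X in (X < _)%E](_ : _ =
    \esum_(p in B) `|(complex.Re `|u p.1 p.2|)%:E|%E); last first.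
    rewrite [RHS]esum_mkcond; apply: eq_esum => -[m n] _.
    case: ifPn => // /negP; rewrite inE /B /= => /not_andP Bmn.
    rewrite (u0 m n).
      by rewrite Normc.normc0 normr0.
    by case: Bmn => /negP; rewrite -leqNgt => ->; rewrite ?orbT.
  rewrite esum_fset //.
  rewrite fsbig_finite //=; apply: lte_sum_pinfty => p _; exact: ltry.
apply: (@lim_near_cst (R[i]^o)); first exact: norm_hausdorff.
exists (maxn M N) => // K /=.
rewrite geq_max => /andP[MK NK].
rewrite (sum_trunc (f := fun m => \sum_(n < K) u m n) MK) => [|m Mm].
  apply: eq_bigr => m _; apply: sum_trunc => // n Nn.
  by rewrite u0 // Nn orbT.
by apply: big1 => n _; rewrite u0 // Mm.
Qed.

(** Along [e] the norms stay above a positive constant from [M] on, so arbitrarily large finite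
    partial sums refute summability and [dsum] takes its default value. *)
Lemma dsum_divergent u (e : nat -> nat * nat) M :
  injective e -> (forall m, u (e m).1 (e m).2 != 0) ->
  (forall m, (M <= m)%N ->
     `|u (e m).1 (e m).2| <= `|u (e m.+1).1 (e m.+1).2|) ->
  dsum u = 0.
Proof.
move=> inj_e u_neq0 u_nd; rewrite /dsum; case: ifP => // /asboolP ucvg.
pose v m := complex.Re `|u (e m).1 (e m).2|.
have v_gt0 m : 0 < v m.
  have : 0 < `|u (e m).1 (e m).2| by rewrite normr_gt0.
  by rewrite ltcE => /andP[].
have v_ge d : v M <= v (M + d)%N.
  elim: d => [|d IHd]; first by rewrite addn0.
  apply: (le_trans IHd); rewrite addnS.
  by have := u_nd (M + d)%N (leq_addr _ _); rewrite lecE => /andP[].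
have := ucvg; rewrite /abs_cvg2 summableE.
set S := esum _ _ => Sfin.
have S_ge d : ((v M *+ d)%:E <= S)%E.
  pose h (i : nat) := e (M + i)%N.
  apply: esum_ge; exists (h @` `I_d).
    by split => //; apply: finite_image; exact: finite_II.
  rewrite fsbig_image => [|i j _ _ /inj_e /addnI //].
  rewrite -fsbig_ord sumEFin lee_fin.
  rewrite -[d in v M *+ d]card_ord -sumr_const; apply: ler_sum => i _.
  exact: le_trans (v_ge i) (ler_norm _).
have S_ge0 : 0 <= fine S by apply: fine_ge0; exact: (S_ge 0%N).
(* With $d$ beyond $S/v(M)$, the $d$ terms starting at [M] already exceed the total $S$. *)
have := archi_boundP (divr_ge0 S_ge0 (ltW (v_gt0 M))).
set d := Num.bound _; rewrite ltr_pdivrMr // mulrC mulr_natr => ltSd.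
by have := S_ge d; rewrite -(fineK Sfin) lee_fin leNgt ltSd.
Qed.

End DoubleSeries.

(** * Termination in one index and its behaviour under backward shifts *)

Section RowTerm.
Variables (K : numFieldType) (a b x : K) (k : nat).

(* The factors of the (m, n) term that can vanish and depend on m only: the   *)
(* series terminates in m exactly when some row_term vanishes.                *)
Definition row_term (s : K) (m : nat) : K :=
  poch a m * poch b m * poch (- s) (m * k) * x ^+ m.

Lemma row_termS s m : row_term s m.+1 =
  row_term s m * ((a + m%:R) * (b + m%:R) * poch (- s + (m * k)%:R) k * x).
Proof. by rewrite /row_term !pochS mulSn addnC pochD exprS; ring. Qed.

Lemma row_term_eq0_le s M m : (M <= m)%N -> row_term s M = 0 -> row_term s m = 0.
Proof.
move=> /subnKC <- s0; elim: (m - M)%N => [|d IHd]; first by rewrite addn0.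
by rewrite addnS row_termS IHd mul0r.
Qed.

(** Only the factor $(-s)_{Mk}$ depends on $s$. If it vanishes then $s=i$ with $i<Mk$, and $s\neq0$
    makes $s-1=i-1$ another zero with the same bound. *)
Lemma shift_closed_terminating M : shift_closed (fun s => row_term s M = 0).
Proof.
move=> s /eqP; rewrite /row_term !mulf_eq0 => s0 s_neq0; apply/eqP.
rewrite !mulf_eq0; case/orP: s0 => [|->]; last by rewrite orbT.
case/orP => [->//|/poch_eq0P[[|i] lt_i si0]].
  by case: s_neq0; apply/eqP; rewrite -oppr_eq0 -[- s]addr0; apply/eqP.
suff -> : poch (- (s - 1)) (M * k) == 0 by rewrite orbT.
apply/poch_eq0P; exists i; first exact: ltnW.
by rewrite opprB addrAC -si0 -natr1; ring.
Qed.

(** Contrapositive: a zero at $s-1$ in row $m$ gives a zero at $s$ in row $m+1$, since $i<mk$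
    implies $i+1<(m+1)k$. *)
Lemma shift_closed_nonterminating :
  (0 < k)%N -> shift_closed (fun s => forall m, row_term s m <> 0).
Proof.
move=> k_gt0 s s_neq0 _ m /eqP; rewrite /row_term !mulf_eq0 => s0.
apply: (s_neq0 m.+1); apply/eqP; rewrite /row_term !pochS exprS !mulf_eq0.
case/orP: s0 => [|->]; last by rewrite !orbT.
case/orP => [/orP[] ->|/poch_eq0P[i lt_i si0]]; rewrite ?orbT //.
suff -> : poch (- s) (m.+1 * k) == 0 by rewrite orbT.
apply/poch_eq0P; exists i.+1; first by rewrite mulSn -add1n leq_add.
by rewrite -si0 -natr1; ring.
Qed.

End RowTerm.

(** * Growth of the ratio of consecutive terms *)

Section Growth.
Variable R : realType.
Implicit Types z : R[i].

Lemma complex_archi z : exists N : nat, `|z| <= N%:R.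
Proof.
have z_real : `|z| \is Num.real by exact: normr_real.
exists (Num.bound (complex.Re `|z|)).
rewrite -(RRe_real z_real) -(rmorph_nat (real_complex R)) lecR.
rewrite ltW // archi_boundP //.
by have := normr_ge0 z; rewrite lecE => /andP[].
Qed.

Lemma norm_addn_bounds z : exists N : nat, forall m : nat, (N <= m)%N ->
  m%:R / 2 <= `|z + m%:R| /\ `|z + m%:R| <= 2 * m%:R.
Proof.
(* For $m\ge2N$ the perturbation $z$ has norm at most $m/2$. *)
have [N zN] := complex_archi z; exists (2 * N)%N => m leNm.
have le_z : `|z| <= m%:R / 2.
  by apply: (le_trans zN); rewrite ler_pdivlMr // -natrM ler_nat mulnC.
split.
  rewrite addrC; apply: le_trans (lerB_normD _ _).
  by rewrite normr_nat lerBrDr [leRHS]splitr lerD2l.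
apply: (le_trans (ler_normD _ _)).
rewrite normr_nat mulr_natl mulr2n lerD2r; apply: (le_trans le_z).
by rewrite ler_pdivrMr // ler_peMr // ler1n.
Qed.

(** One factor already gives the bound, and the others have norm at least 1. *)
Lemma norm_poch_ge (N k : nat) z : (0 < k)%N -> 1 <= N%:R / 2 :> R[i] ->
  (forall i : nat, N%:R / 2 <= `|z + i%:R|) -> N%:R / 2 <= `|poch z k|.
Proof.
move=> k_gt0 N_ge z_ge; case: k k_gt0 => // k _.
elim: k => [|k IHk]; first by rewrite pochS poch0 mul1r.
by rewrite pochS normrM; apply: (le_trans IHk); rewrite ler_peMr // (le_trans N_ge).
Qed.

Lemma row_ratio_ge1 (a b c s x : R[i]) k :
  (0 < k)%N -> x != 0 -> (forall j : nat, c + j%:R != 0) ->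
  exists M : nat, forall m : nat, (M <= m)%N ->
    1 <= `|(a + m%:R) * (b + m%:R) * poch (- s + (m * k)%:R) k * x
           / ((c + m%:R) * m.+1%:R)|.
Proof.
move=> k_gt0 x_neq0 c_neq0.
have [Na aN] := norm_addn_bounds a; have [Nb bN] := norm_addn_bounds b.
have [Nc cN] := norm_addn_bounds c; have [Ns sN] := norm_addn_bounds (- s).
(* Three factors of the numerator are at least $m/2$ and the two of the denominator at most $2m$, so
   the ratio is at least $m|x|/32$. *)
have [Nx xN] := complex_archi (32 / x).
exists (Na + Nb + Nc + Ns + Nx + 2)%N => m le_m.
have [le_am le_bm le_cm le_sm le_xm] :
  [/\ Na <= m, Nb <= m, Nc <= m, Ns <= m & Nx <= m]%N by split; lia.
have [m_ge2 lt_m2] : (2 <= m)%N /\ (m < 2 * m)%N by lia.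
have [am bm cm] : [/\ m%:R / 2 <= `|a + m%:R|, m%:R / 2 <= `|b + m%:R| &
    `|c + m%:R| <= 2 * m%:R].
  by split; [case: (aN m le_am) | case: (bN m le_bm) | case: (cN m le_cm)].
have pm : m%:R / 2 <= `|poch (- s + (m * k)%:R) k|.
  apply: norm_poch_ge => // [|i].
    by rewrite ler_pdivlMr // mul1r ler_nat.
  have le_mi : (m <= m * k + i)%N.
    by rewrite (leq_trans (leq_pmulr m k_gt0)) ?leq_addr.
  rewrite -addrA -natrD; apply: le_trans (sN _ (leq_trans le_sm le_mi)).1.
  by rewrite ler_pM2r ?invr_gt0 // ler_nat.
have xm : 32 <= m%:R * `|x|.
  have nx_gt0 : 0 < `|x| by rewrite normr_gt0.
  rewrite -ler_pdivrMr //; move: xN; rewrite normrM normfV normr_nat => xN.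
  by apply: (le_trans xN); rewrite ler_nat.
have m_ge0 : 0 <= m%:R :> R[i] by exact: ler0n.
have m2_ge0 : 0 <= m%:R / 2 :> R[i] by rewrite divr_ge0.
have d_gt0 : 0 < `|c + m%:R| * m.+1%:R by rewrite mulr_gt0 ?normr_gt0 ?ltr0n.
rewrite !normrM normfV normrM normr_nat ler_pdivlMr // mul1r.
apply: (@le_trans _ _ (2 * m%:R * (2 * m%:R))).
  have m1 : m.+1%:R <= 2 * m%:R :> R[i] by rewrite -natrM ler_nat.
  exact: ler_pM (normr_ge0 _) (ler0n _ _) cm m1.
apply: (@le_trans _ _ (m%:R / 2 * (m%:R / 2) * (m%:R / 2) * `|x|)).
  rewrite [leLHS](_ : _ = m%:R * m%:R / 8 * 32); last by field.
  rewrite [leRHS](_ : _ = m%:R * m%:R / 8 * (m%:R * `|x|)); last by field.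
  by apply: ler_wpM2l => //; rewrite divr_ge0 // mulr_ge0.
by repeat (apply: ler_pM; rewrite ?mulr_ge0 //).
Qed.

End Growth.

(** * The two regimes of the Appell function *)

Section Appell.
Variables (R : realType) (a1 a2 b1 b2 c x y : R[i]) (k1 k2 : nat).
Hypotheses (c_neq0 : forall j : nat, c + j%:R != 0).
Local Notation U := (coefF3 a1 a2 b1 b2 c k1 k2).
Local Notation F := (fun s1 s2 => appellF3 a1 a2 b1 b2 c s1 s2 k1 k2 x y).
Local Notation row1 := (row_term a1 b1 x k1).
Local Notation row2 := (row_term a2 b2 y k2).

(** The last factor never vanishes, so zeros of a term come from one of the two rows alone. *)
Lemma coefF3_row_term m n s1 s2 : U m n s1 s2 * x ^+ m * y ^+ n =
  row1 s1 m * row2 s2 n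
  * ((-1) ^+ (m * k1) * (-1) ^+ (n * k2)
     / (poch c (m + n) * (m`!)%:R * (n`!)%:R)).
Proof. by rewrite /coefF3 /row_term; ring. Qed.

Lemma appellF3_terminating M N s1 s2 : row1 s1 M = 0 -> row2 s2 N = 0 ->
  F s1 s2 = \sum_(m < M) \sum_(n < N) U m n s1 s2 * x ^+ m * y ^+ n.
Proof.
move=> r1 r2; apply: dsum_finite => m n /orP[Mm|Nn]; rewrite coefF3_row_term.
  by rewrite (row_term_eq0_le Mm r1) !mul0r.
by rewrite (row_term_eq0_le Nn r2) mulr0 mul0r.
Qed.

Lemma appellF3_divergent s1 s2 : (0 < k1)%N ->
  (forall m, row1 s1 m <> 0) -> F s1 s2 = 0.
Proof.
move=> k1_gt0 r1_neq0.
have x_neq0 : x != 0.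
  by apply/eqP => x0; case: (r1_neq0 1%N); rewrite /row_term x0 expr1 mulr0.
have [M ratio_ge1] := row_ratio_ge1 a1 b1 s1 k1_gt0 x_neq0 c_neq0.
have fact_neq0 m : (m`!)%:R != 0 :> R[i] by rewrite pnatr_eq0 -lt0n fact_gt0.
have p_neq0 m : poch c m != 0 by exact: poch_neq0.
pose v m := row1 s1 m * ((-1) ^+ (m * k1) / (poch c m * (m`!)%:R)).
have uv m : U m 0%N s1 s2 * x ^+ m * y ^+ 0 = v m.
  rewrite coefF3_row_term /v /row_term !mul0n !poch0 !expr0 addn0 fact0.
  by rewrite !mulr1.
(* The terms with $n=0$ suffice: there the row factor in $n$ is 1, whatever $a_2,b_2,y,t_2$ are. *)
apply: (@dsum_divergent _ _ (fun m => (m, 0%N)) M) => [m n []//|m|m le_Mm] /=.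
  rewrite uv /v mulf_neq0 //; first exact/eqP.
  by rewrite mulf_neq0 ?signr_eq0 ?invr_neq0 ?mulf_neq0.
rewrite !uv.
have -> : v m.+1 = v m * ((a1 + m%:R) * (b1 + m%:R)
    * poch (- s1 + (m * k1)%:R) k1 * x / ((c + m%:R) * m.+1%:R)) * (-1) ^+ k1.
  rewrite /v row_termS mulSn exprD pochS factS natrM.
  have m1_neq0 : 1 + m%:R != 0 :> R[i] by rewrite nat1r pnatr_eq0.
  by field; rewrite m1_neq0 fact_neq0 p_neq0 c_neq0.
rewrite [leRHS]normrM normrX normrN1 expr1n mulr1.
by rewrite [leRHS]normrM ler_peMr // ratio_ge1.
Qed.

End Appell.

Lemma coefF3C (K : fieldType) (a1 a2 b1 b2 c : K) k1 k2 m n s1 s2 :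
  coefF3 a1 a2 b1 b2 c k1 k2 m n s1 s2 = coefF3 a2 a1 b2 b1 c k2 k1 n m s2 s1.
Proof. by rewrite /coefF3 addnC [_ * _ * (n`!)%:R]mulrAC; congr (_ / _); ring. Qed.

Lemma appellF3C (R : realType) (a1 a2 b1 b2 c s1 s2 x y : R[i]) k1 k2 :
  appellF3 a1 a2 b1 b2 c s1 s2 k1 k2 x y = appellF3 a2 a1 b2 b1 c s2 s1 k2 k1 y x.
Proof.
rewrite /appellF3 -dsumC; congr dsum; apply/funext => m; apply/funext => n.
by rewrite coefF3C mulrAC.
Qed.

Section Equations.
Variables (R : realType) (c : R[i]).
Hypotheses (c_neq0 : forall j : nat, c + j%:R != 0).

(** If either index fails to terminate, $F$ agrees with 0 on a shift-closed domain. Otherwise one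
    pair of bounds $M,N$ works at all the points reached by shifts, and $F$ agrees with a single
    finite sum. *)
Lemma appellF3_eqn1 (a1 a2 b1 b2 x y t1 t2 : R[i]) (k1 k2 : nat) :
  (0 < k1)%N -> (0 < k2)%N ->
  eqn1 a1 b1 c x k1 k2 (fun s1 s2 => appellF3 a1 a2 b1 b2 c s1 s2 k1 k2 x y)
    t1 t2 = 0.
Proof.
move=> k1_gt0 k2_gt0.
have trueC : shift_closed (fun _ : R[i] => True) by [].
have [[M r1]|/forallNP r1] :=
  pselect (exists M, row_term a1 b1 x k1 t1 M = 0); last first.
  rewrite (eqn1_eq_on _ _ _ _ _ _ (g := fun _ _ => 0)
    (shift_closed_nonterminating k1_gt0) trueC _ r1 I) ?eqn1_0 // => s1 s2 s1r _.
  exact: appellF3_divergent.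
have [[N r2]|/forallNP r2] :=
  pselect (exists N, row_term a2 b2 y k2 t2 N = 0); last first.
  rewrite (eqn1_eq_on _ _ _ _ _ _ (g := fun _ _ => 0)
    trueC (shift_closed_nonterminating k2_gt0) _ I r2) ?eqn1_0 // => s1 s2 _ s2r.
  by rewrite appellF3C; exact: appellF3_divergent.
rewrite (eqn1_eq_on _ _ _ _ _ _ (@shift_closed_terminating _ a1 b1 x k1 M)
  (@shift_closed_terminating _ a2 b2 y k2 N)
  (@appellF3_terminating _ a1 a2 b1 b2 c x y k1 k2 M N) r1 r2).
apply: comb_eqn1 => // n.
transitivity (row_term a1 b1 x k1 t1 M *
  (poch a2 n * poch b2 n * (-1) ^+ (M * k1) * (-1) ^+ (n * k2)
   * poch (- t2) (n * k2) / (poch c (M + n) * (M`!)%:R * (n`!)%:R))).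
  by rewrite /coefF3 /row_term; ring.
by rewrite r1 mul0r.
Qed.

End Equations.

(** * Exchange of the two variables, and the theorem *)

Lemma opC_swap (K : fieldType) (c : K) k1 k2 f t1 t2 :
  opC k1 k2 c f t1 t2 = opC k2 k1 c (fun s2 s1 => f s1 s2) t2 t1.
Proof. by rewrite /opC [X in X + _]addrC. Qed.

Lemma on2_Theta_opC_swap (K : fieldType) (c : K) k1 k2 f t1 t2 :
  on2 (@Theta K) (opC k1 k2 c f) t1 t2
  = on1 (@Theta K) (opC k2 k1 c (fun s2 s1 => f s1 s2)) t2 t1.
Proof. by rewrite /on2 /on1 !ThetaE !(opC_swap c k1 k2). Qed.

Lemma iter_on2_rho (K : comPzRingType) k (f : K -> K -> K) t1 t2 :
  iter k (on2 (@rho K)) f t1 t2 = iter k (on1 (@rho K)) (fun s2 s1 => f s1 s2) t2 t1.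
Proof.
rewrite iter_on1_rho; elim: k t2 => [|k IHk] t2; first by rewrite subr0.
by rewrite iterS /on2 /rho IHk -addrA -opprD nat1r.
Qed.

Lemma iter_on2_rho_opA2 (K : fieldType) k a b (f : K -> K -> K) t1 t2 :
  iter k (on2 (@rho K)) (opA2 k a (opA2 k b f)) t1 t2
  = iter k (on1 (@rho K)) (opA1 k a (opA1 k b (fun s2 s1 => f s1 s2))) t2 t1.
Proof. by rewrite iter_on2_rho. Qed.

(* The first two equations are those of the function F_3^(1); the last two    *)
(* are the same equations for its defining double series read as a formal     *)
(* power series in x and y, which has content for all t1, t2.                 *)
Theorem theorem2p1 (R : realType) (a1 a2 b1 b2 c t1 t2 x y : R[i])
    (k1 k2 : nat) (hc : forall j : nat, complex.Re c <> - j%:R)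
    (hk1 : (0 < k1)%N) (hk2 : (0 < k2)%N) (hx : `|x| < 1) (hy : `|y| < 1) :
  let F := fun s1 s2 : R[i] => appellF3 a1 a2 b1 b2 c s1 s2 k1 k2 x y in
  let U := coefF3 a1 a2 b1 b2 c k1 k2 in
  [/\ on1 (@Theta R[i]) (opC k1 k2 c F) t1 t2
        - k1%:R * (-1) ^+ k1 * poch (- t1) k1 * x
          * iter k1 (on1 (@rho R[i])) (opA1 k1 a1 (opA1 k1 b1 F)) t1 t2 = 0,
      on2 (@Theta R[i]) (opC k1 k2 c F) t1 t2
        - k2%:R * (-1) ^+ k2 * poch (- t2) k2 * y
          * iter k2 (on2 (@rho R[i])) (opA2 k2 a2 (opA2 k2 b2 F)) t1 t2 = 0,
      forall m n : nat,
        on1 (@Theta R[i]) (opC k1 k2 c (U m n)) t1 t2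
        - k1%:R * (-1) ^+ k1 * poch (- t1) k1
          * mulx (fun p q => iter k1 (on1 (@rho R[i]))
                               (opA1 k1 a1 (opA1 k1 b1 (U p q)))) m n t1 t2 = 0
    & forall m n : nat,
        on2 (@Theta R[i]) (opC k1 k2 c (U m n)) t1 t2
        - k2%:R * (-1) ^+ k2 * poch (- t2) k2
          * muly (fun p q => iter k2 (on2 (@rho R[i]))
                               (opA2 k2 a2 (opA2 k2 b2 (U p q)))) m n t1 t2 = 0].
Proof.
move=> F U.
(* Taking real parts in $c+j=0$ would give $\Re c=-j$. *)
have c_neq0 j : c + j%:R != 0.
  apply/eqP => /(congr1 (@complex.Re R)); rewrite raddfD /= => cj0.
  apply: (hc j); apply/eqP; rewrite -addr_eq0 -cj0.
  by rewrite -(rmorph_nat (real_complex R)).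
have swapF : (fun s2 s1 => F s1 s2)
    = (fun s2 s1 => appellF3 a2 a1 b2 b1 c s2 s1 k2 k1 y x).
  by apply/funext => s2; apply/funext => s1; exact: appellF3C.
have swapU m n : (fun s2 s1 => U m n s1 s2) = coefF3 a2 a1 b2 b1 c k2 k1 n m.
  by apply/funext => s2; apply/funext => s1; exact: coefF3C.
split=> [||m n|m n].
- exact: appellF3_eqn1.
- rewrite on2_Theta_opC_swap iter_on2_rho_opA2 swapF.
  exact: (appellF3_eqn1 c_neq0 a2 a1 b2 b1 y x t2 t1 hk2 hk1).
- exact: coefF3_formal1.
- have := coefF3_formal1 a2 a1 b2 b1 c_neq0 hk2 hk1 n m t2 t1.
  (* For $n=0$ both [muly] and the exchanged [mulx] reduce to 0. *)
  rewrite on2_Theta_opC_swap swapU; case: n => [//|n] /=.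
  by rewrite iter_on2_rho_opA2 swapU.
Qed.
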